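(* Every nonseparable complex Hilbert space $H$ contains a dense linear subspace $K \subseteq H$ such that no subset of $K$ is an orthonormal basis for $H$.
   Context: A Hilbert space is a complete inner product space over $\mathbb{C}$. A linear subspace is not required to be closed. An orthonormal basis for $H$ is an orthonormal family whose closed linear span is $H$ (not a Hamel basis). *)

(* Defs.v *)
From HB Require Import structures.
From mathcomp Require Import all_boot all_order all_algebra.
From mathcomp Require Import boolp classical_sets cardinality reals topology.
From mathcomp Require Import normedtype complex.

Set Implicit Arguments.
Unset Strict Implicit.
Unset Printing Implicit Defensive.

Import Order.TTheory GRing.Theory Num.Theory numFieldNormedType.Exports.

Local Open Scope classical_set_scope.
Local Open Scope ring_scope.
Local Open Scope complex_scope.

(* The inner product is linear in its first argument and conjugate-linear in
   the second.  The norm takes its values in the nonnegative reals of R[i]; the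
   partial order of R[i] makes [0 < inner x x] include that [inner x x] is real. *)
HB.mixin Record CompleteNormedModule_isHilbert (R : realType) (H : Type)
    & CompleteNormedModule R[i] H := {
  inner : {dot H for @Num.conj R[i]} ;
  sqr_norm_inner : forall x : H, `|x| ^+ 2 = inner x x
}.

#[short(type="hilbertType")]
HB.structure Definition Hilbert (R : realType) :=
  { H of CompleteNormedModule R[i] H & CompleteNormedModule_isHilbert R H }.

Definition separable (T : topologicalType) : Prop :=
  exists D : set T, countable D /\ dense D.

Definition linear_span (K : pzRingType) (V : lmodType K) (B : set V) : set V :=
  [set x | exists (n : nat) (c : 'I_n -> K) (b : 'I_n -> V),
     (forall i, B (b i)) /\ x = \sum_(i < n) c i *: b i].

(* A subset is regarded as a family indexed by itself. *)
Definition orthonormal_set (R : realType) (H : hilbertType R) (B : set H) :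
    Prop :=
  forall x y : H, B x -> B y -> inner x y = (x == y)%:R.

Definition orthonormal_basis (R : realType) (H : hilbertType R) (B : set H) :
    Prop :=
  orthonormal_set B /\ closure (linear_span B) = [set: H].

(* Main.v *)
Require Import Defs.
From mathcomp Require Import all_boot all_order all_algebra.
From mathcomp Require Import boolp classical_sets functions cardinality reals topology.
From mathcomp Require Import normedtype sequences complex ring.

(* If [H] has no orthonormal basis, [K = H] works.  Otherwise let [S] be one; it
   is uncountable.  Label the nodes [u : seq bool] of the binary tree by distinct
   elements [e u] of [S], and choose an uncountable set [A] of other elements of
   [S] together with distinct branches [phi s], for [s] in [A].
   [K] consists of the [y] such that for each [s] in [A] eventually
   [<y, e (phi s | n)> = 2^-n <y, s>].  It is dense because it contains
   [s + \sum_n 2^-n e (phi s | n)]: distinct branches share finitely many nodes.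
   Let [B] in [K] be an orthonormal basis.  Each [s] in [A] has [<b, s> != 0]
   for some [b] in [B], hence [<b, e u> != 0] for some node [u].  By Bessel only
   countably many [b] are not orthogonal to the countable family [e], and each
   of them is orthogonal to all but countably many [s]: [A] would be countable. *)

Set Implicit Arguments.
Unset Strict Implicit.
Unset Printing Implicit Defensive.

Import Order.TTheory GRing.Theory Num.Theory numFieldNormedType.Exports.

Local Open Scope classical_set_scope.
Local Open Scope card_scope.
Local Open Scope ring_scope.

(** * Comparability of cardinals, and uncountable sets of binary sequences *)

Section Cardinality.

(** By Zorn's lemma there is a maximal partial bijection between [A] and [B]. It exhausts one of the
    two sets, since otherwise an unmatched pair could be added to it. *)
Lemma card_le_total (T U : Type) (A : set T) (B : set U) :
  (A #<= B) || (B #<= A).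
Proof.
elim/Ppointed: T => T in A *; first by rewrite [A]emptyE card_ge0.
elim/Ppointed: U => U in B *; first by rewrite [B]emptyE card_ge0 orbT.
pose partial_bij (G : set (T * U)) := G `<=` A `*` B /\
  forall p q, G p -> G q -> (p.1 = q.1 <-> p.2 = q.2).
have [F FP totF|G [[GAB Ginj] Gmax]] := @Zorn_bigcup _ partial_bij.
  split=> [p [G FG Gp]|p q [G FG Gp] [G' FG' G'q]].
    exact: (FP G FG).1.
  have [GG'|G'G] := totF _ _ FG FG'.
    by apply: (FP G' FG').2 => //; exact: GG'.
  by apply: (FP G FG).2 => //; exact: G'G.
have [[a Aa aG]|domG] :=
  pselect (exists2 a, A a & forall b, ~ G (a, b)); last first.
  have GA a : A a -> exists b, G (a, b).
    by move=> Aa; apply: contrapT => /forallNP aG; apply: domG; exists a.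
  apply/orP; left; apply/pcard_leP/injfunPex.
  have [f fG] : {f : T -> U & forall a, A a -> G (a, f a)}.
    apply: (@choice _ _ (fun a b => A a -> G (a, b))) => a.
    have [/GA[b Gab]|nAa] := pselect (A a); first by exists b.
    by exists point => /nAa.
  exists f => [a /fG /GAB[]//|a a' /set_mem/fG Ga /set_mem/fG Ga' /= faa'].
  exact/(Ginj _ _ Ga Ga').
have [[b Bb bG]|codG] :=
  pselect (exists2 b, B b & forall a, ~ G (a, b)); last first.
  have GB b : B b -> exists a, G (a, b).
    by move=> Bb; apply: contrapT => /forallNP bG; apply: codG; exists b.
  apply/orP; right; apply/pcard_leP/injfunPex.
  have [f fG] : {f : U -> T & forall b, B b -> G (f b, b)}.
    apply: (@choice _ _ (fun b a => B b -> G (a, b))) => b.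
    have [/GB[a' Gab]|nBb] := pselect (B b); first by exists a'.
    by exists point => /nBb.
  exists f => [b /fG /GAB[]//|b b' /set_mem/fG Gb /set_mem/fG Gb' /= fbb'].
  exact/(Ginj _ _ Gb Gb').
exfalso; apply: (Gmax ((a, b) |` G)).
  split; first by move=> p; right.
  by move=> /(_ (a, b) (or_introl erefl)) /aG.
split=> [_ [->//|/GAB//]|[p1 p2] [q1 q2] [[-> ->]|Gp] [[-> ->]|Gq]] //=.
- by split=> e; [case: (aG q2)|case: (bG q1)]; rewrite /= ?e // -e.
- by split=> e; [case: (aG p2)|case: (bG p1)]; rewrite /= -?e // e.
- exact: (Ginj _ _ Gp Gq).
Qed.

Lemma uncountable_cantor : ~ countable [set: nat -> bool].
Proof.
move=> /countable_injP[f fI].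
(* Cantor's diagonal: [x] is the set of all [n] that do not code, under [f], a set containing
   [n]. *)
pose x n := ~~ `[< exists2 y, f y = n & y n >].
have xE : x (f x) <-> ~ x (f x).
  split=> [/asboolPn nex xfx|nxfx]; first by apply: nex; exists x.
  apply/asboolPn => -[y fyx yfx]; apply: nxfx.
  by rewrite -[x in x (f _)](fI y) ?in_setT.
by case: xE; case: (x (f x)) => [/(_ isT)[]|_ /(_ notF)].
Qed.

(** Comparability makes this independent of the continuum hypothesis: either [B] embeds in Cantor
    space and [A] is [B], or Cantor space embeds in [B] and [A] is its image, with [phi] inverting
    the embedding. *)
Lemma uncountable_sub_cantor (T : Type) (B : set T) : ~ countable B ->
  exists A (phi : T -> nat -> bool),
    [/\ A `<=` B, ~ countable A & {in A &, injective phi}].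
Proof.
elim/Ppointed: T => T in B *; first by rewrite [B]emptyE; case.
move=> Bunc; have /orP[] := card_le_total B [set: nat -> bool].
  by move=> /pcard_injP[phi phiI]; exists B, phi; split.
move=> /pcard_leP/injfunPex[g gB gI].
have [phi phiE] :
    {phi : T -> nat -> bool & forall t, range g t -> g (phi t) = t}.
  apply: (@choice _ _ (fun t x => range g t -> g x = t)) => t.
  have [[x _ gx]|nt] := pselect (range g t); first by exists x.
  by exists point => /nt.
exists (range g), phi; split.
- by move=> _ [x _ <-]; exact: gB.
- move=> gc; apply: uncountable_cantor; apply: sub_countable gc.
  by apply/pcard_leP/injfunPex; exists g => // x _; exists x.
- by move=> s t /set_mem/phiE {2}<- /set_mem/phiE {2}<- ->.
Qed.

End Cardinality.

(** * Closures of sets of vectors *)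

Section Closure.
Context {K : numFieldType} {V : normedModType K}.
Implicit Types (x y : V) (A B : set V).

Lemma closure_normP A x :
  closure A x <-> forall eps : K, 0 < eps -> exists2 a, A a & `|x - a| < eps.
Proof.
split=> [Ax eps eps0|Ax B /nbhs_ballP[eps /= eps0 epsB]].
  have [a [Aa]] := Ax _ (nbhsx_ballx x eps eps0).
  by rewrite -ball_normE; exists a.
have [a Aa xa] := Ax _ eps0.
by exists a; split=> //; apply: epsB; rewrite -ball_normE.
Qed.

Lemma closure_addr A : (forall x y, A x -> A y -> A (x + y)) ->
  forall x y, closure A x -> closure A y -> closure A (x + y).
Proof.
move=> AD x y /closure_normP Ax /closure_normP Ay.
apply/closure_normP => eps eps0.
have [a Aa xa] := Ax _ (divr_gt0 eps0 (ltr0n _ 2)).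
have [b Ab yb] := Ay _ (divr_gt0 eps0 (ltr0n _ 2)).
exists (a + b); first exact: AD.
by rewrite opprD addrACA [eps]splitr (le_lt_trans (ler_normD _ _)) ?ltrD.
Qed.

Lemma closure_scale A (c : K) : (forall x, A x -> A (c *: x)) ->
  forall x, closure A x -> closure A (c *: x).
Proof.
move=> AZ x /closure_normP Ax; apply/closure_normP => eps eps0.
have c0 : 0 < `|c| + 1 by rewrite ltr_wpDl.
have [a Aa xa] := Ax _ (divr_gt0 eps0 c0).
exists (c *: a); first exact: AZ.
rewrite -scalerBr normrZ; move: xa; rewrite ltr_pdivlMr// mulrC.
by apply: le_lt_trans; rewrite ler_wpM2r// lerDl.
Qed.

(** Multiples are only required to lie in the closure, so that [A] may also be a set of combinations
    with rational coefficients. *)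
Lemma linear_span_sub_closure A B : A 0 ->
    (forall x y, A x -> A y -> A (x + y)) ->
    (forall (c : K) x, B x -> closure A (c *: x)) ->
  linear_span B `<=` closure A.
Proof.
move=> A0 AD AB _ [n [c [b [Bb ->]]]]; apply: big_ind.
- exact: subset_closure.
- exact: closure_addr.
- by move=> i _; exact: AB.
Qed.

Lemma closure_dense A : closure A = setT -> dense A.
Proof.
move=> AT U [x Ux] Uo; have : closure A x by rewrite AT.
by move=> /(_ U); rewrite setIC; apply; exact: open_nbhs_nbhs.
Qed.

End Closure.

(** * Complex scalars: archimedean bounds, rational approximation, separability *)

Section Complex.
Context {R : realType}.

Lemma complex_archi (x : R[i]) : 0 <= x -> exists n, x < n%:R.
Proof.
move=> x0; exists (Num.bound (complex.Re x)).
rewrite -(RRe_real (ger0_real x0)).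
rewrite -[X in _ < X](rmorph_nat (real_complex R)) ltcR.
by apply: archi_boundP; rewrite -ler0c RRe_real ?ger0_real.
Qed.

Lemma complex_rat_approx (c : R[i]) (eps : R[i]) : 0 < eps ->
  exists p q : rat, `|c - Complex (ratr p) (ratr q)| < eps.
Proof.
move=> eps0.
have eE : eps = (complex.Re eps)%:C%C by rewrite RRe_real ?gtr0_real.
have e0 : 0 < complex.Re eps / 2 by rewrite divr_gt0// -ltcR -eE.
have approx (x : R) : exists p : rat, `|x - ratr p| < complex.Re eps / 2.
  have [|p] := @rat_in_itvoo R (x - complex.Re eps / 2) (x + complex.Re eps / 2).
    by rewrite ltrD2l gtrN.
  by rewrite in_itv/= -ltr_distlC; exists p.
have [p pc] := approx (complex.Re c); have [q qc] := approx (complex.Im c).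
exists p, q.
have -> : c - Complex (ratr p) (ratr q) =
    (complex.Re c - ratr p)%:C%C + 'i%C * (complex.Im c - ratr q)%:C%C.
  by rewrite [LHS]complexE; case: c {pc qc}.
rewrite (le_lt_trans (ler_normD _ _))// normrM eE.
rewrite [complex.Re eps]splitr [X in _ < X]rmorphD.
have normC (x : R) : `|x%:C%C| = `|x|%:C%C :> R[i].
  by rewrite normc_def/= expr0n addr0 sqrtr_sqr.
have normi : `|'i%C| = 1 :> R[i].
  by rewrite normc_def/= expr0n expr1n add0r sqrtr1.
by rewrite normi mul1r !normC ltrD// ltcR.
Qed.

Lemma countable_span_separable (V : normedModType R[i]) (B : set V) :
  countable B -> closure (linear_span B) = setT -> separable V.
Proof.
move=> /countable_injP[f fI] BT.
have [b bE] : {b : nat -> V & forall x, B x -> b (f x) = x}.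
  suff [b bE] : {b : nat -> V & forall n x, B x -> f x = n -> b n = x}.
    by exists b => x Bx; exact: bE.
  apply: (@choice _ _ (fun n y => forall x, B x -> f x = n -> y = x)) => n.
  have [[x Bx fx]|nBn] := pselect (exists2 x, B x & f x = n).
    by exists x => y By fy; apply: fI; rewrite ?inE// fx.
  by exists 0 => y By fy; case: nBn; exists y.
(* A term is coded by the rational real and imaginary parts of its coefficient and the index of its
   vector, so the combinations are indexed by a countable type. *)
pose comb (l : seq (rat * rat * nat)) : V :=
  \sum_(t <- l) Complex (ratr t.1.1) (ratr t.1.2) *: b t.2.
exists (range comb); split.
  by apply: sub_countable (card_image_le _ _) _; exact: countableP.
apply: closure_dense; apply/seteqP; split=> // x _.
have : closure (linear_span B) x by rewrite BT.
rewrite [X in _ -> X x](closure_id _).1; last exact: closed_closure.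
apply: closureS; apply: linear_span_sub_closure.
- by exists [::] => //; rewrite /comb big_nil.
- move=> _ _ [l _ <-] [l' _ <-]; exists (l ++ l') => //.
  by rewrite /comb big_cat.
- move=> c y By; apply/closure_normP => eps eps0.
  have y0 : 0 < `|y| + 1 by rewrite ltr_wpDl.
  have [p [q pqc]] := complex_rat_approx c (divr_gt0 eps0 y0).
  exists (comb [:: (p, q, f y)]); first by exists [:: (p, q, f y)].
  rewrite /comb big_seq1 /= bE// -scalerBl normrZ.
  move: pqc; rewrite ltr_pdivlMr//; apply: le_lt_trans.
  by rewrite ler_wpM2l// lerDl.
Qed.

End Complex.

(** * Orthonormal families, Bessel's inequality and convergent series *)

Section Inner.
Context {R : realType} {H : hilbertType R}.
Implicit Types (x y v s h : H) (A B S : set H) (g : nat -> H).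
Local Notation "''[' x , y ]" := (inner x y).

Lemma inner_conj x y : '[x, y] = ('[y, x])^*%R.
Proof. by rewrite hermC mul1r. Qed.

Lemma inner_eq0C x y : ('[x, y] == 0) = ('[y, x] == 0).
Proof. by rewrite inner_conj conjC_eq0. Qed.

Lemma innerZl (a : R[i]) x y : '[a *: x, y] = a * '[x, y].
Proof. by rewrite linearZl_LR. Qed.

Lemma innerZr (a : R[i]) x y : '[x, a *: y] = a^*%R * '[x, y].
Proof. by rewrite linearZr_LR. Qed.

(** Expand the squared norm of [v - w], where [w] is the orthogonal projection of [v] onto the span
    of the family. *)
Lemma bessel (I : finType) (s : I -> H) v :
    (forall i j, '[s i, s j] = (i == j)%:R) ->
  \sum_i `|'[v, s i]| ^+ 2 <= `|v| ^+ 2.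
Proof.
move=> ortho; pose w := \sum_i '[v, s i] *: s i.
have vw : '[v, w] = \sum_i `|'[v, s i]| ^+ 2.
  rewrite linear_sumr; apply: eq_bigr => i _.
  by rewrite /= innerZr mulrC normCK.
have ww : '[w, w] = \sum_i `|'[v, s i]| ^+ 2.
  rewrite {1}/w linear_sumlz; apply: eq_bigr => i _.
  rewrite /= innerZl normCK; congr (_ * _).
  rewrite linear_sumr (bigD1 i)//= big1 => [|j ji].
    by rewrite innerZr ortho eqxx mulr1 addr0.
  by rewrite innerZr ortho eq_sym (negPf ji) mulr0.
have := dnorm_ge0 (@inner R H) (v - w).
rewrite dnormB vw ww -sqr_norm_inner.
have -> : (\sum_i `|'[v, s i]| ^+ 2)^*%R = \sum_i `|'[v, s i]| ^+ 2.
  by apply/conj_Creal/ger0_real; rewrite sumr_ge0// => i _; rewrite exprn_ge0.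
by rewrite opprD addrA addrK subr_ge0.
Qed.

Lemma le_norm_inner x s : '[s, s] = 1 -> `|'[x, s]| <= `|x|.
Proof.
move=> s1; have := @bessel unit (fun=> s) x.
rewrite big_const card_unit/= addr0 => xs.
by rewrite -(@ler_pXn2r _ 2)// ?nnegrE// xs// => -[] [].
Qed.

Lemma inner_closure_eq0 A s : '[s, s] = 1 -> (forall a, A a -> '[a, s] = 0) ->
  forall x, closure A x -> '[x, s] = 0.
Proof.
move=> s1 As x /closure_normP Ax; apply/eqP; apply: contrapT => /negP xs.
have [|a Aa] := Ax `|'[x, s]|; first by rewrite normr_gt0.
have := le_norm_inner (x - a) s1; rewrite linearBl /= (As a)// subr0.
by move=> le_xs /(le_lt_trans le_xs); rewrite ltxx.
Qed.

Lemma inner_linear_span_eq0 B s : (forall b, B b -> '[b, s] = 0) ->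
  forall x, linear_span B x -> '[x, s] = 0.
Proof.
move=> Bs _ [n [c [b [Bb ->]]]]; rewrite linear_sumlz big1// => i _.
by rewrite /= innerZl Bs ?mulr0.
Qed.

Lemma countable_inner_neq0 S v : orthonormal_set S ->
  countable [set s | S s /\ '[v, s] != 0].
Proof.
(* [F k] collects the [s] whose squared coefficient exceeds [1/k]; the product form makes [F 0]
   empty. *)
move=> So; pose F k := [set s | S s /\ 1 < k%:R * `|'[v, s]| ^+ 2].
apply: (@sub_countable _ _ _ (\bigcup_k F k)).
  apply: subset_card_le => s [Ss vs].
  have vs0 : 0 < `|'[v, s]| ^+ 2 by rewrite exprn_gt0// normr_gt0.
  have [|k k_lt] := @complex_archi R (`|'[v, s]| ^+ 2)^-1.
    by rewrite invr_ge0 ltW.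
  by exists k => //; split=> //; rewrite -ltr_pdivrMr// mul1r.
apply: bigcup_countable => // k _; apply: finite_set_countable; apply: contrapT.
move=> /infiniteP/pcard_leP/injfunPex[g gF gI].
(* If [F k] were infinite, [n] of its vectors with [n] above [k] times the squared norm of [v] would
   violate Bessel's inequality. *)
have [|n n_lt] := @complex_archi R (k%:R * `|v| ^+ 2).
  by rewrite mulr_ge0// exprn_ge0.
have go (i j : 'I_n) : '[g i, g j] = (i == j)%:R.
  have [Sgi _] := gF i Logic.I; have [Sgj _] := gF j Logic.I.
  by rewrite (So _ _ Sgi Sgj) (inj_in_eq gI) ?in_setT.
have := bessel v go.
move=> /(ler_wpM2l (ler0n _ k))/le_lt_trans/(_ n_lt); rewrite mulr_sumr.
suff : n%:R <= \sum_(i < n) k%:R * `|'[v, g i]| ^+ 2.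
  by move=> /le_lt_trans/[apply]; rewrite ltxx.
rewrite -[n in n%:R]card_ord -sumr_const; apply: ler_sum => i _.
by apply/ltW; exact: (gF i Logic.I).2.
Qed.

Lemma cvg_inner (u : nat -> H) h s c : '[s, s] = 1 -> u @ \oo --> h ->
  (\forall n \near \oo, '[u n, s] = c) -> '[h, s] = c.
Proof.
move=> s1 uh uc; apply/eqP; rewrite -subr_eq0; apply: contrapT => /negP hc.
rewrite -normr_gt0 in hc.
have [n [uhn ucn]] := filter_ex (filterI (cvgr_dist_lt _ _ uh _ hc) uc).
have := le_norm_inner (h - u n) s1; rewrite linearBl /= ucn.
by move=> /le_lt_trans/(_ uhn); rewrite ltxx.
Qed.

Lemma cvg_half_series g : (forall n, `|g n| <= 1) ->
  cvgn (fun n => \sum_(k < n) 2^-1 ^+ k *: g k).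
Proof.
move=> g1; set u := fun n => _.
(* The right-hand side is the exact sum of [2^-j] for [m <= j < m + k], which lets the induction on
   [k] close. *)
have bound m k : `|u (m + k)%N - u m| <= 2 * 2^-1 ^+ m * (1 - 2^-1 ^+ k).
  elim: k => [|k IHk]; first by rewrite addn0 !subrr normr0 mulr0.
  rewrite addnS {1}/u big_ord_recr /= -/(u _) addrAC.
  rewrite (le_trans (ler_normD _ _))//.
  have -> : 2 * 2^-1 ^+ m * (1 - 2^-1 ^+ k.+1) =
      2 * 2^-1 ^+ m * (1 - 2^-1 ^+ k) + 2^-1 ^+ (m + k) :> R[i].
    by rewrite exprS exprD; field.
  rewrite lerD// normrZ ger0_norm ?exprn_ge0 ?invr_ge0//.
  by rewrite ler_piMr ?exprn_ge0 ?invr_ge0.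
apply/cauchy_cvgP/cauchyP => eps eps0.
(* Any [n] above [2 / eps] will do, because [n < 2^n]. *)
have [|n n_lt] := @complex_archi R (2 * eps^-1).
  by rewrite mulr_ge0// invr_ge0 ltW.
exists (u n); rewrite /= -ball_normE; exists n => // m /= nm.
rewrite distrC -(subnKC nm) (le_lt_trans (bound _ _))//.
apply: (@le_lt_trans _ _ (2 * 2^-1 ^+ n)).
  rewrite ler_piMr ?mulr_ge0 ?exprn_ge0 ?invr_ge0//.
  by rewrite gerBl exprn_ge0 ?invr_ge0.
rewrite exprVn ltr_pdivrMr ?exprn_gt0// mulrC -ltr_pdivrMr//.
by rewrite (lt_le_trans n_lt)// -natrX ler_nat ltnW// ltn_expl.
Qed.

(** Both inner products are eventually constant along the partial sums, so they pass to the
    limit. *)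
Lemma orthonormal_series g :
    (forall m n, '[g m, g n] = (m == n)%:R) ->
  exists h : H, [/\ (fun n => \sum_(k < n) 2^-1 ^+ k *: g k) @ \oo --> h,
    forall n, '[h, g n] = 2^-1 ^+ n &
    forall s, '[s, s] = 1 -> (forall n, '[g n, s] = 0) -> '[h, s] = 0].
Proof.
move=> go; pose u n := \sum_(k < n) 2^-1 ^+ k *: g k.
have /cvg_ex[/= h uh] : cvgn u.
  apply: cvg_half_series => n.
  by rewrite -(@ler_pXn2r _ 2)// ?nnegrE// sqr_norm_inner go eqxx expr1n.
exists h; split=> // [n|s s1 gs].
  apply: (cvg_inner _ uh); first by rewrite go eqxx.
  exists n.+1 => // m /= nm; rewrite linear_sumlz.
  rewrite (bigD1 (Ordinal nm))//= big1 => [|k kn].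
    by rewrite innerZl go eqxx mulr1 addr0.
  by rewrite innerZl go -val_eqE/= in kn *; rewrite (negPf kn) mulr0.
apply: (cvg_inner s1 uh); apply: nearW => n.
by rewrite linear_sumlz big1// => k _; rewrite /= innerZl gs mulr0.
Qed.

End Inner.

(** * The subspace defined by branches of the binary tree *)

Section Tree.
Context {R : realType} {H : hilbertType R}.
Implicit Types (y s t : H) (A B S : set H) (e : seq bool -> H).
Implicit Types (phi : H -> nat -> bool).
Local Notation "''[' x , y ]" := (inner x y).

(** [mkseq (phi s) n] is the node at depth [n] on the branch of [s]. The weights [2^-n] are nonzero,
    so a component along [s] forces one along a node, and summable, so a vector with these
    coefficients exists. *)
Definition tree_subspace e A phi : set H :=
  [set y | forall s, A s ->
    \forall n \near \oo, '[y, e (mkseq (phi s) n)] = 2^-1 ^+ n * '[y, s]].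

Lemma tree_subspace0 e A phi : tree_subspace e A phi 0.
Proof. by move=> s As; apply: nearW => n; rewrite !linear0l mulr0. Qed.

Lemma tree_subspace_linear e A phi a x y :
  tree_subspace e A phi x -> tree_subspace e A phi y ->
  tree_subspace e A phi (a *: x + y).
Proof.
move=> Kx Ky s As; apply: filterS2 (Kx s As) (Ky s As) => n xn yn.
by rewrite !linearDl /= !innerZl xn yn mulrDr mulrCA.
Qed.

Lemma tree_subspaceD e A phi x y : tree_subspace e A phi x ->
  tree_subspace e A phi y -> tree_subspace e A phi (x + y).
Proof.
by move=> Kx Ky; rewrite -[x]scale1r; exact: tree_subspace_linear.
Qed.

Lemma tree_subspaceZ e A phi a x : tree_subspace e A phi x ->
  tree_subspace e A phi (a *: x).
Proof.
rewrite -[a *: x]addr0 => Kx.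
by apply: tree_subspace_linear => //; exact: tree_subspace0.
Qed.

Lemma tree_subspace_no_basis e A phi : orthonormal_set A -> ~ countable A ->
  forall B, B `<=` tree_subspace e A phi -> ~ orthonormal_basis B.
Proof.
move=> Ao Aunc B BK [Bo BT]; apply: Aunc.
(* [B'] consists of the basis vectors not orthogonal to every node vector; it is countable because
   there are countably many nodes. *)
pose B' := \bigcup_u [set b | B b /\ '[e u, b] != 0].
apply: (@sub_countable _ _ _
  (\bigcup_(b in B') [set s | A s /\ '[b, s] != 0])); last first.
  apply: bigcup_countable => [|b _]; last exact: countable_inner_neq0.
  by apply: bigcup_countable => // u _; exact: countable_inner_neq0.
apply: subset_card_le => s As.
have s1 : '[s, s] = 1 by rewrite Ao// eqxx.
(* Otherwise [s] would be orthogonal to the closed span of [B], hence to itself. *)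
have [b Bb bs] : exists2 b, B b & '[b, s] != 0.
  apply: contrapT => nB; have : '[s, s] = 0.
    apply: (@inner_closure_eq0 _ _ (linear_span B)) => //; last by rewrite BT.
    apply: inner_linear_span_eq0 => b Bb; apply: contrapT => /eqP bs.
    by apply: nB; exists b.
  by rewrite s1 => /eqP; rewrite oner_eq0.
exists b => //=; have [n bn] := filter_ex (BK b Bb s As).
exists (mkseq (phi s) n) => //; split=> //.
by rewrite inner_eq0C bn mulf_neq0// expf_neq0// invr_eq0 pnatr_eq0.
Qed.

(** It suffices to put [S] in the closure. Node vectors and elements of [S] outside [A] lie in [K]
    itself; an [s] in [A] is a difference of two vectors of the closure. *)
Lemma tree_subspace_dense e A phi S : orthonormal_basis S -> injective e ->
    range e `<=` S -> A `<=` S `\` range e -> {in A &, injective phi} ->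
  dense (tree_subspace e A phi).
Proof.
move=> [So ST] eI eS AS phiI; set K := tree_subspace e A phi.
have eo u v : '[e u, e v] = (u == v)%:R.
  by rewrite So ?(inj_eq eI)//; apply: eS; eexists.
have e_perp s : S s -> ~ range e s -> forall u, '[e u, s] = 0.
  move=> Ss es u; rewrite So//; last by apply: eS; exists u.
  by case: eqP => // eus; case: es; exists u.
have Se s : S s -> ~ range e s -> forall u, '[s, e u] = 0.
  by move=> Ss es u; apply/eqP; rewrite inner_eq0C e_perp.
have S1 s : S s -> '[s, s] = 1 by move=> Ss; rewrite So// eqxx.
have Ke u : K (e u).
  (* Beyond depth [size u], no node of a branch equals [u], so both sides vanish. *)
  move=> s /AS[Ss es]; exists (size u).+1 => // n /= un.
  rewrite (e_perp s)// mulr0 eo; case: eqP => // uE.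
  by move: un; rewrite uE size_mkseq ltnn.
have KS : S `<=` closure K.
  move=> s Ss; have [[u _ <-]|es] := pselect (range e s).
    exact: subset_closure.
  have [As|nAs] := pselect (A s); last first.
    apply: subset_closure => t At; have [St et] := AS t At; apply: nearW => n.
    rewrite Se// So//; case: eqP => [st|_]; last by rewrite mulr0.
    by rewrite st in nAs.
  have go m n : '[e (mkseq (phi s) m), e (mkseq (phi s) n)] = (m == n)%:R.
    rewrite eo; congr (_%:R); congr nat_of_bool.
    apply/eqP/eqP => [/(congr1 size)|->//]; by rewrite !size_mkseq.
  (* [h] supplies the coefficients [2^-n] along the branch that [s] demands; its partial sums are
     combinations of node vectors, hence in [K]. *)
  have [h [uh hn h0]] := orthonormal_series go.
  have Kh : closure K h.
    apply/closure_normP => eps eps0.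
    have [n un] := filter_ex (cvgr_dist_lt _ _ uh _ eps0).
    exists (\sum_(k < n) 2^-1 ^+ k *: e (mkseq (phi s) k)) => //.
    apply: big_ind; first exact: tree_subspace0.
      exact: tree_subspaceD.
    by move=> k _; apply: tree_subspaceZ; exact: Ke.
  have Khs : K (h + s).
    move=> t At; have [St et] := AS t At.
    have ht : '[h, t] = 0 by apply: h0 => [|n]; [exact: S1|exact: e_perp].
    (* For [t = s] both sides equal [2^-n], at every depth. *)
    have [ts|ts] := eqVneq t s.
      apply: nearW => n.
      by rewrite ts !linearDl /= hn Se// addr0 -ts ht add0r ts S1// mulr1.
    (* The branches of [t] and [s] differ at index [N], so they share no node deeper than [N], and
       both sides vanish there. *)
    have [N phiN] : exists N, phi t N != phi s N.
      apply: contrapT => /forallNP phits; move/eqP: ts; apply.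
      apply: phiI; rewrite ?inE//; apply/funext => n.
      exact/eqP/negPn/negP/phits.
    exists N.+1 => // n /= Nn.
    rewrite !linearDl /= ht (Se s)// (So s t)// eq_sym (negPf ts) !addr0 mulr0.
    apply: h0 => [|k]; first by rewrite eo eqxx.
    rewrite eo; case: eqP => // kn; case/eqP: phiN.
    have nk : k = n by move/(congr1 size): kn; rewrite !size_mkseq.
    by have := congr1 (nth false ^~ N) kn; rewrite nk !nth_mkseq.
  (* Write [s] as [-h + (h + s)]. *)
  rewrite -[s](addKr h) -scaleN1r.
  apply: closure_addr; first exact: tree_subspaceD.
    by apply: closure_scale => // x; exact: tree_subspaceZ.
  exact: subset_closure.
apply: closure_dense; apply/seteqP; split=> // x _.
rewrite [X in X x](closure_id _).1; last exact: closed_closure.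
have : closure (linear_span S) x by rewrite ST.
apply: closureS; apply: linear_span_sub_closure.
- exact: tree_subspace0.
- exact: tree_subspaceD.
- by move=> c s /KS Ks; apply: closure_scale => // z; exact: tree_subspaceZ.
Qed.

End Tree.

Theorem proposition3 (R : realType) (H : hilbertType R)
    (nonsepH : ~ separable H) :
  exists K : set H,
    [/\ GRing.submod_closed [in K], dense K &
        forall B : set H, B `<=` K -> ~ orthonormal_basis B].
Proof.
have [[S Sb]|noS] := pselect (exists S : set H, orthonormal_basis S); last first.
  exists setT; split.
  - by split=> [|a x y _ _]; rewrite inE.
  - by apply: closure_dense; rewrite closureT.
  - by move=> B _ Bb; apply: noS; exists B.
have [So ST] := Sb.
have Sunc : ~ countable S.
  by move=> Sc; apply: nonsepH; exact: countable_span_separable ST.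
have /infiniteP/pcard_leP/injfunPex[g gS gI] : infinite_set S.
  by move=> /finite_set_countable.
(* [pickle] numbers the nodes injectively, turning a sequence in [S] into a family indexed by the
   tree. *)
pose e (u : seq bool) := g (pickle u).
have eI : injective e.
  by move=> u v /gI guv; apply: (pcan_inj pickleK); apply: guv; rewrite in_setT.
have eS : range e `<=` S by move=> _ [u _ <-]; exact: gS.
(* Removing the countably many node vectors leaves [S] uncountable. *)
have [|A [phi [AS Aunc phiI]]] := @uncountable_sub_cantor _ (S `\` range e).
  move=> Sec; apply: Sunc.
  apply: (@sub_countable _ _ _ (\bigcup_b if b then S `\` range e else range e)).
    apply: subset_card_le => s Ss.
    by have [es|es] := pselect (range e s); [exists false|exists true].
  apply: bigcup_countable => // -[] _ //.
  by apply: sub_countable (card_image_le _ _) _; exact: countableP.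
exists (tree_subspace e A phi); split.
- split=> [|a x y]; rewrite !inE; first exact: tree_subspace0.
  exact: tree_subspace_linear.
- exact: tree_subspace_dense Sb eI eS AS phiI.
- apply: tree_subspace_no_basis => // x y /AS[Sx _] /AS[Sy _]; exact: So.
Qed.
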